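(* Let $(M,\phi_\alpha,\xi_\alpha,\eta_\alpha,g)$, $\alpha\in\{1,2,3\}$, be a $3$-quasi-Sasakian manifold of dimension $4n+3$ and rank $4l+3$, with $[\xi_\alpha,\xi_\beta]=c\,\xi_\gamma$ for every even permutation $(\alpha,\beta,\gamma)$ of $\{1,2,3\}$. Then the Riemannian curvature tensor $R$ satisfies: (i) $R(X,Y)\xi_\alpha=0$ for any $X,Y\in\Gamma(\mathcal{E}^{4m})$ and $\alpha\in\{1,2,3\}$; (ii) $R(X,\xi_\beta)\xi_\alpha=0$ for any $X\in\Gamma(\mathcal{E}^{4m})$ and $\alpha,\beta\in\{1,2,3\}$; (iii) $R(X,\xi_\alpha)\xi_\alpha=\frac{c^2}{4}X$ for any $X\in\Gamma(\mathcal{E}^{4l})$ and $\alpha\in\{1,2,3\}$; (iv) $R(X,\xi_\beta)\xi_\alpha=0$ for any $X\in\Gamma(\mathcal{E}^{4l})$ and $\alpha\neq\beta$. Consequently, writing $K(\xi_\alpha,X)=g(R(X,\xi_\alpha)\xi_\alpha,X)$, one has $K(\xi_\alpha,X)=0$ for any $X\in\Gamma(\mathcal{E}^{4m})$ and $K(\xi_\alpha,X)=\frac{c^2}{4}\|X\|^2$ for any $X\in\Gamma(\mathcal{E}^{4l})$.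
   Context: Conventions: for a $1$-form $\eta$, $2d\eta(X,Y)=X(\eta(Y))-Y(\eta(X))-\eta([X,Y])$; $R(X,Y)=[\nabla_X,\nabla_Y]-\nabla_{[X,Y]}$ with $\nabla$ the Levi-Civita connection of $g$. An almost contact metric structure $(\phi,\xi,\eta,g)$ consists of a $(1,1)$-tensor $\phi$, a vector field $\xi$, a $1$-form $\eta$ and a Riemannian metric $g$ with $\phi^2=-I+\eta\otimes\xi$, $\eta(\xi)=1$, $g(\phi X,\phi Y)=g(X,Y)-\eta(X)\eta(Y)$. Its fundamental $2$-form is $\Phi(X,Y)=g(X,\phi Y)$. It is normal if $[\phi,\phi]+2d\eta\otimes\xi=0$ ($[\phi,\phi]$ the Nijenhuis torsion), and quasi-Sasakian if it is normal and $d\Phi=0$. A quasi-Sasakian structure has rank $2p+1$ if $\eta\wedge(d\eta)^p\neq0$ and $(d\eta)^{p+1}=0$ on $M$; only structures of constant rank are considered. A $3$-quasi-Sasakian manifold is a $(4n+3)$-dimensional manifold with three quasi-Sasakian structures $(\phi_\alpha,\xi_\alpha,\eta_\alpha,g)$, $\alpha=1,2,3$, with the same metric $g$, such that for every even permutation $(\alpha,\beta,\gamma)$ of $\{1,2,3\}$: $\phi_\gamma=\phi_\alpha\phi_\beta-\eta_\beta\otimes\xi_\alpha=-\phi_\beta\phi_\alpha+\eta_\alpha\otimes\xi_\beta$, $\xi_\gamma=\phi_\alpha\xi_\beta=-\phi_\beta\xi_\alpha$, $\eta_\gamma=\eta_\alpha\circ\phi_\beta=-\eta_\beta\circ\phi_\alpha$.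 It is known that there is $c\in\mathbb{R}$ with $[\xi_\alpha,\xi_\beta]=c\,\xi_\gamma$ for every even permutation, and that $\eta_1,\eta_2,\eta_3$ have the same rank, called the rank of $M$; it is $4l+1$ if $c=0$ and $4l+3$ if $c\ne0$, for some $0\le l\le n$. Put $m=n-l$ and $\mathcal{H}=\bigcap_{\alpha=1}^3\ker\eta_\alpha$. Let $\mathcal{E}^{4m}=\{X\in\mathcal{H}: i_Xd\eta_\alpha=0\text{ for some }\alpha\}$ (equivalently, for all $\alpha$), a distribution of rank $4m$, and let $\mathcal{E}^{4l}$ be its orthogonal complement in $\mathcal{H}$. *)

(* Defs.v *)
From HB Require Import structures.
From mathcomp Require Import all_boot all_order all_fingroup all_algebra.
From mathcomp Require Import all_classical all_reals all_analysis.
From mathcomp Require Import ring.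

Set Implicit Arguments.
Unset Strict Implicit.
Unset Printing Implicit Defensive.

Import Order.TTheory GRing.Theory Num.Theory.
Import numFieldNormedType.Exports.

Local Open Scope classical_set_scope.
Local Open Scope ring_scope.

Section EuclideanSmoothness.
Variables (R : realType) (d : nat).
Implicit Types (U : set 'rV[R]_d) (f g : 'rV[R]_d -> R).

Definition partial (i : 'I_d) f : 'rV[R]_d -> R :=
  fun x => 'D_(delta_mx 0 i : 'rV[R]_d) f x.

(* Meant for open U, on which continuity and differentiability of the total
   function f at the points of U are those of its restriction to U. *)
Fixpoint Ck (k : nat) U f : Prop :=
  (forall x, U x -> {for x, continuous f}) /\
  if k is k'.+1 then
    forall i : 'I_d,
      (forall x, U x -> derivable f x (delta_mx 0 i : 'rV[R]_d)) /\
      Ck k' U (partial i f)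
  else True.

Definition smooth_on U f : Prop := forall k, Ck k U f.

Lemma Ck_eq k U f g : open U -> {in U, f =1 g} -> Ck k U f -> Ck k U g.
Proof.
move=> oU.
have near_U (h h' : 'rV[R]_d -> R) x : {in U, h =1 h'} -> U x -> \forall y \near x, h y = h' y.
  move=> hh' Ux; apply: filterS (open_nbhs_nbhs (conj oU Ux)) => y Uy.
  by apply: hh'; rewrite inE.
have ctsg (h h' : 'rV[R]_d -> R) x : {in U, h =1 h'} -> U x -> {for x, continuous h} ->
    {for x, continuous h'}.
  move=> hh' Ux ch; suff : h' @ nbhs x --> h x by rewrite hh'// inE.
  by apply: cvg_trans ch; apply: near_eq_cvg; exact: near_U hh' Ux.
elim: k f g => [|k IH] f g fg /= [cf Hf].
  by split=> // x Ux; exact: (ctsg _ _ _ fg Ux (cf x Ux)).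
split=> [x Ux|i]; first by exact: (ctsg _ _ _ fg Ux (cf x Ux)).
have [df Hd] := Hf i; split=> [x Ux|].
  exact: near_eq_derivable (near_U _ _ _ fg Ux) (df x Ux).
apply: IH Hd => x; rewrite inE => Ux.
exact: near_eq_derive (near_U _ _ _ fg Ux).
Qed.

Lemma Ck_le k U f : Ck k.+1 U f -> Ck k U f.
Proof.
elim: k f => [|k IH] f /= [cf Hf]; first by split.
by split=> // i; have [df Hd] := Hf i; split=> //; exact: IH Hd.
Qed.

Lemma Ck_cst k U (a : R) : open U -> Ck k U (cst a).
Proof.
move=> oU; elim: k a => [|k IH] a /=; split=> //;
  try by move=> *; exact: cst_continuous.
move=> i; split=> [x _|]; first exact: derivable_cst.
by apply: Ck_eq (IH 0) => // x _; rewrite /partial derive_cst.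
Qed.

Lemma CkD k U f g : open U -> Ck k U f -> Ck k U g -> Ck k U (f + g).
Proof.
move=> oU; elim: k f g => [|k IH] f g /= [cf Hf] [cg Hg]; split=> //;
  try by move=> x Ux; apply: continuousD; [exact: cf|exact: cg].
move=> i; have [df Df] := Hf i; have [dg Dg] := Hg i.
split=> [x Ux|]; first by apply: derivableD; [exact: df|exact: dg].
apply: Ck_eq (IH _ _ Df Dg) => // x; rewrite inE => Ux.
by rewrite /partial deriveD//; [exact: df|exact: dg].
Qed.

Lemma CkM k U f g : open U -> Ck k U f -> Ck k U g -> Ck k U (f * g).
Proof.
move=> oU; elim: k f g => [|k IH] f g /=.
  move=> [cf _] [cg _]; split=> // x Ux.
  by apply: continuousM; [exact: cf|exact: cg].
move=> Hf Hg; have [Cf Cg] := (Ck_le Hf, Ck_le Hg).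
move: Hf Hg => [cf Hf] [cg Hg]; split.
  by move=> x Ux; apply: continuousM; [exact: cf|exact: cg].
move=> i; have [df Df] := Hf i; have [dg Dg] := Hg i.
split=> [x Ux|]; first by apply: derivableM; [exact: df|exact: dg].
apply: (@Ck_eq k U (f * partial i g + g * partial i f)) => //.
  move=> x; rewrite inE => Ux.
  by rewrite /partial deriveM//; [exact: df|exact: dg].
by apply: CkD => //; apply: IH.
Qed.

End EuclideanSmoothness.

Section Manifold.
Variables (R : realType) (d : nat).

(* chart_inv is only meaningful on the image of the chart. *)
Record chart (M : topologicalType) := Chart {
  chart_dom : set M;
  chart_map : M -> 'rV[R]_d;
  chart_inv : 'rV[R]_d -> M;
  chart_dom_open : open chart_dom;
  chart_img_open : open (chart_map @` chart_dom);
  chart_mapK : forall x, chart_dom x -> chart_inv (chart_map x) = x;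
  chart_map_continuous :
    forall x, chart_dom x -> {for x, continuous chart_map};
  chart_inv_continuous :
    forall y, (chart_map @` chart_dom) y -> {for y, continuous chart_inv} }.

Definition chart_img (M : topologicalType) (c : chart M) : set 'rV[R]_d :=
  chart_map c @` chart_dom c.

Definition smooth_transition (M : topologicalType) (c1 c2 : chart M) : Prop :=
  forall j : 'I_d,
    smooth_on (chart_map c1 @` (chart_dom c1 `&` chart_dom c2))
      (fun y => chart_map c2 (chart_inv c1 y) 0 j).

Record smoothManifold := SmoothManifold {
  manifold_space :> topologicalType;
  atlas : set (chart manifold_space);
  manifold_hausdorff : hausdorff_space manifold_space;
  manifold_second_countable : @second_countable manifold_space;
  atlas_cover : forall x, exists2 c, atlas c & chart_dom c x;
  atlas_smooth :
    forall c1 c2, atlas c1 -> atlas c2 -> smooth_transition c1 c2 }.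

Variable M : smoothManifold.

Definition smooth (f : M -> R) : Prop :=
  forall c, @atlas M c -> smooth_on (chart_img c) (f \o chart_inv c).

Definition smooth_pred : {pred M -> R} := fun f => `[< smooth f >].

Lemma smooth_subring : subring_closed smooth_pred.
Proof.
split=> [|f g /asboolP sf /asboolP sg|f g /asboolP sf /asboolP sg];
  apply/asboolP => c Ac k; have oU : open (chart_img c) := @chart_img_open _ c.
- exact: (Ck_cst _ (1 : R) oU).
- have -> : (f - g) \o chart_inv c =
      f \o chart_inv c + cst (-1) * (g \o chart_inv c).
    by apply/funext => y; congr (_ + _); exact: (esym (mulN1r _)).
  apply: CkD => //; first exact: sf.
  by apply: CkM => //; [exact: Ck_cst|exact: sg].
- by apply: (@CkM R d k _ (f \o chart_inv c) (g \o chart_inv c)) => //;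
    [exact: sf|exact: sg].
Qed.

Lemma smooth_submod : subsemimod_closed smooth_pred.
Proof.
have [_ _ sM] := smooth_subring.
split=> [|a f sf].
  exact: (GRing.zmod_closedD (GRing.subring_closedB smooth_subring)).
have -> : a *: f = (cst a : M -> R) * f by apply/funext.
apply: sM => //; apply/asboolP => c Ac k; exact: (Ck_cst _ a (@chart_img_open _ c)).
Qed.

Record Cinf := MkCinf { cinf_fun :> M -> R; _ : cinf_fun \in smooth_pred }.

HB.instance Definition _ := [isSub for cinf_fun].
HB.instance Definition _ := [Choice of Cinf by <:].
HB.instance Definition _ :=
  GRing.SubChoice_isSubComPzRing.Build (M -> R) smooth_pred Cinf smooth_subring.
HB.instance Definition _ :=
  GRing.SubZmodule_isSubLmodule.Build R (M -> R) smooth_pred Cinf smooth_submod.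

Lemma cinf_scaleAl (a : R) (f g : Cinf) : a *: (f * g) = (a *: f) * g.
Proof.
apply: val_inj; rewrite !(linearZ, rmorphM)/=; apply/funext => x.
exact: mulrA.
Qed.

Definition cinf_const (a : R) : Cinf := a *: (1 : Cinf).

(* Smooth vector fields are the derivations of the R-algebra of smooth
   functions; the regular module Cinf^o is there to make them a Cinf-module. *)
Definition is_derivation (D : Cinf -> Cinf^o) : Prop :=
  [/\ forall f g, D (f + g) = D f + D g,
      forall (a : R) f, D (a *: f) = (a *: (D f : Cinf) : Cinf)
    & forall f g, D (f * g) = (D f : Cinf) * g + f * (D g : Cinf) ].

Definition derivation_pred : {pred Cinf -> Cinf^o} :=
  fun D => `[< is_derivation D >].

Lemma derivation_submod : subsemimod_closed derivation_pred.
Proof.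
split; first split.
- apply/asboolP; split=> [f g|a f|f g] /=.
  + by rewrite addr0.
  + by rewrite scaler0.
  + by rewrite mul0r mulr0 addr0.
- move=> D E /asboolP[Da Dz Dm] /asboolP[Ea Ez Em]; apply/asboolP.
  have DE f : (D + E) f = (D f : Cinf) + (E f : Cinf) by [].
  split=> [f g|a f|f g]; rewrite !DE.
  + by rewrite Da Ea addrACA.
  + by rewrite Dz Ez scalerDr.
  + by rewrite Dm Em mulrDl mulrDr addrACA.
- move=> h D /asboolP[Da Dz Dm]; apply/asboolP.
  have hD f : (h *: D) f = h * (D f : Cinf) by [].
  split=> [f g|a f|f g]; rewrite !hD.
  + by rewrite Da mulrDr.
  + by rewrite Dz mulrC -cinf_scaleAl mulrC.
  + by rewrite Dm mulrDr mulrA mulrCA.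
Qed.

Record vfield :=
  MkVfield { vfield_fun :> Cinf -> Cinf; _ : vfield_fun \in derivation_pred }.

HB.instance Definition _ :=
  [isSub of vfield for vfield_fun : vfield -> (Cinf -> Cinf^o)].
HB.instance Definition _ := [Choice of vfield by <:].
HB.instance Definition _ :=
  GRing.SubChoice_isSubLmodule.Build Cinf (Cinf -> Cinf^o) derivation_pred
    vfield derivation_submod.

Implicit Types X Y Z : vfield.

Lemma vfieldP X : is_derivation X.
Proof. by case: X => D /= /asboolP. Qed.

Lemma lie_bracket_subproof X Y :
  (fun f => X (Y f) - Y (X f) : Cinf^o) \in derivation_pred.
Proof.
have [[Xa Xz Xm] [Ya Yz Ym]] := (vfieldP X, vfieldP Y).
apply/asboolP; split=> [f g|a f|f g].
- by rewrite Ya !Xa Ya opprD addrACA.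
- by rewrite Yz !Xz Yz scalerBr.
- by rewrite Ym Xm Xa !Xm Ya !Ym; ring.
Qed.

Definition lie_bracket X Y : vfield := MkVfield (lie_bracket_subproof X Y).

End Manifold.

Section Geometry.
Variables (R : realType) (d : nat) (M : smoothManifold R d).

Local Notation C := (Cinf M).
Local Notation V := (vfield M).

(* Tensor fields are given by their action on smooth vector fields, as
   C^oo(M)-multilinear maps: {scalar V} for 1-forms and {linear V -> V} for
   (1,1)-tensors. *)

(* The tangent vector of X at x vanishes. *)
Definition zero_at (x : M) (X : V) : Prop := forall f : C, X f x = 0.

Record riemannian_metric := RiemannianMetric {
  riem :> V -> V -> C;
  riem_sym : forall X Y : V, riem X Y = riem Y X;
  riem_add : forall X Y Z : V, riem (X + Y) Z = riem X Z + riem Y Z;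
  riem_scale : forall (f : C) (X Y : V), riem (f *: X) Y = f * riem X Y;
  riem_pos : forall (x : M) (X : V), ~ zero_at x X -> 0 < riem X X x }.

Definition connection := V -> V -> V.

Record levi_civita (g : riemannian_metric) (nabla : connection) : Prop := {
  nabla_addl : forall X Y Z : V, nabla (X + Y) Z = nabla X Z + nabla Y Z;
  nabla_scalel : forall (f : C) (X Y : V), nabla (f *: X) Y = f *: nabla X Y;
  nabla_addr : forall X Y Z : V, nabla X (Y + Z) = nabla X Y + nabla X Z;
  nabla_leibniz : forall (X : V) (f : C) (Y : V),
    nabla X (f *: Y) = X f *: Y + f *: nabla X Y;
  nabla_torsion_free : forall X Y : V, nabla X Y - nabla Y X = lie_bracket X Y;
  nabla_metric : forall X Y Z : V,
    X (g Y Z) = g (nabla X Y) Z + g Y (nabla X Z) }.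

Definition curvature (nabla : connection) (X Y Z : V) : V :=
  nabla X (nabla Y Z) - nabla Y (nabla X Z) - nabla (lie_bracket X Y) Z.

(* A k-form takes a family of k vector fields; d1, d2 and wedge use the
   normalization in which 2 d eta (X, Y) = X eta(Y) - Y eta(X) - eta [X, Y],
   that is, the factors 1/(k+1) in d and 1/(k+l)! in wedge. *)
Definition form (k : nat) := ('I_k -> V) -> C.

Definition d1 (eta : V -> C) (X Y : V) : C :=
  2^-1 *: (X (eta Y) - Y (eta X) - eta (lie_bracket X Y)).

Definition d2 (w : V -> V -> C) (X Y Z : V) : C :=
  3^-1 *: (X (w Y Z) + Y (w Z X) + Z (w X Y)
           - w (lie_bracket X Y) Z - w (lie_bracket Y Z) X
           - w (lie_bracket Z X) Y).

Definition form1 (eta : V -> C) : form 1 := fun X => eta (X ord0).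

Definition form2 (w : V -> V -> C) : form 2 := fun X => w (X ord0) (X ord_max).

Definition wedge (k l : nat) (a : form k) (b : form l) : form (k + l) :=
  fun X => ((k + l)`!%:R^-1 : R) *: \sum_(s : 'S_(k + l))
    (-1) ^+ odd_perm s *
    (a (fun i => X (s (lshift l i))) * b (fun j => X (s (rshift k j)))).

Unset Implicit Arguments.
Fixpoint wedge_pow (w : form 2) (p : nat) : form (p * 2) :=
  match p return form (p * 2) with
  | 0 => fun _ => 1
  | p'.+1 => wedge w (wedge_pow w p')
  end.
Set Implicit Arguments.

Definition has_rank (eta : V -> C) (r : nat) : Prop :=
  exists p : nat, [/\ r = p.*2.+1,
    forall x : M, exists X : 'I_(1 + p * 2) -> V,
      wedge (form1 eta) (wedge_pow (form2 (d1 eta)) p) X x != 0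
    & forall X : 'I_(p.+1 * 2) -> V,
        wedge_pow (form2 (d1 eta)) p.+1 X = 0 ].

Definition nijenhuis (phi : V -> V) (X Y : V) : V :=
  phi (phi (lie_bracket X Y)) + lie_bracket (phi X) (phi Y)
  - phi (lie_bracket (phi X) Y) - phi (lie_bracket X (phi Y)).

Record almost_contact_metric (g : riemannian_metric)
    (phi : {linear V -> V}) (xi : V) (eta : {scalar V}) : Prop := {
  phi_sq : forall X : V, phi (phi X) = - X + eta X *: xi;
  eta_xi : eta xi = 1;
  phi_metric : forall X Y : V, g (phi X) (phi Y) = g X Y - eta X * eta Y }.

Definition fundamental_form (g : riemannian_metric) (phi : V -> V) (X Y : V) :
  C := g X (phi Y).

Definition normal_structure (phi : V -> V) (xi : V) (eta : V -> C) : Prop :=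
  forall X Y : V, nijenhuis phi X Y + (d1 eta X Y *+ 2) *: xi = 0.

Record quasi_sasakian (g : riemannian_metric)
    (phi : {linear V -> V}) (xi : V) (eta : {scalar V}) : Prop := {
  qs_acm : almost_contact_metric g phi xi eta;
  qs_normal : normal_structure phi xi eta;
  qs_closed : forall X Y Z : V, d2 (fundamental_form g phi) X Y Z = 0 }.

Definition even_permutation (a b c : 'I_3) : Prop :=
  exists2 s : 'S_3, ~~ odd_perm s &
    [/\ a = s (inord 0), b = s (inord 1) & c = s (inord 2)].

Record three_quasi_sasakian (g : riemannian_metric)
    (phi : 'I_3 -> {linear V -> V}) (xi : 'I_3 -> V) (eta : 'I_3 -> {scalar V})
    : Prop := {
  tqs_qs : forall a, quasi_sasakian g (phi a) (xi a) (eta a);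
  tqs_phi : forall a b c, even_permutation a b c -> forall X : V,
    phi c X = phi a (phi b X) - eta b X *: xi a /\
    phi c X = - phi b (phi a X) + eta a X *: xi b;
  tqs_xi : forall a b c, even_permutation a b c ->
    xi c = phi a (xi b) /\ xi c = - phi b (xi a);
  tqs_eta : forall a b c, even_permutation a b c -> forall X : V,
    eta c X = eta a (phi b X) /\ eta c X = - eta b (phi a X) }.

(* A distribution is given by the relation "the tangent vector X_x lies in its
   fibre at x"; every tangent vector at x is X_x for some vector field X. *)
Definition distribution := M -> V -> Prop.

Definition section_of (D : distribution) (X : V) : Prop := forall x, D x X.

Definition horizontal (eta : 'I_3 -> {scalar V}) : distribution :=
  fun x X => forall a, eta a X x = 0.

Definition E4m (eta : 'I_3 -> {scalar V}) : distribution :=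
  fun x X => horizontal eta x X /\
    exists a, forall Y : V, d1 (eta a) X Y x = 0.

Definition E4l (g : riemannian_metric) (eta : 'I_3 -> {scalar V}) :
  distribution :=
  fun x X => horizontal eta x X /\ forall Y : V, E4m eta x Y -> g X Y x = 0.

(* Not normalized: the sectional curvature of the plane spanned by an
   orthogonal pair xi, X with xi of unit length, multiplied by g X X. *)
Definition sectional (g : riemannian_metric) (nabla : connection) (xi X : V) :
  C := g (curvature nabla X xi xi) X.

End Geometry.

Arguments wedge_pow {R d M} w p X.

(* Main.v *)
(* On horizontal fields put B_a X = nabla_X xi_a. As Phi_b is closed and xi_a is
   Killing, for every even permutation (a, b, e) the Lie derivative of phi_b
   along xi_a is -2 B_e, and that of phi_e is 2 B_b. Differentiating
   phi_e = phi_a phi_b along xi_a gives B_b = - phi_a B_e, so that S = phi_a B_a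
   does not depend on a, is symmetric, commutes with every phi_a, and
   B_a = - phi_a S. Differentiating B_b = - phi_b S along xi_a, where B_b has
   derivative c B_e, gives S^2 = (c/2) S. Hence E^{4m} = ker S and S = c/2 on
   E^{4l}, while R(X, xi_a) xi_a = S^2 X and R(X, xi_b) xi_a = 0 for b <> a and
   horizontal X. *)

Require Import Defs.
From HB Require Import structures.
From mathcomp Require Import all_boot all_order all_fingroup all_algebra.
From mathcomp Require Import all_classical all_reals all_analysis.
From mathcomp Require Import ring.

Set Implicit Arguments.
Unset Strict Implicit.
Unset Printing Implicit Defensive.

Import Order.TTheory GRing.Theory Num.Theory.
Local Open Scope ring_scope.

Local Notation "[ 'lie' X , Y ]" := (lie_bracket X Y) (at level 0).

(** * Vector fields as derivations, and the Lie bracket *)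

Section VectorFields.
Variables (R : realType) (d : nat) (M : smoothManifold R d).
Implicit Types (X Y Z : vfield M) (f h : Cinf M).

Lemma vfield_ext X Y : (forall f, X f = Y f) -> X = Y.
Proof. by move=> XY; apply: val_inj; apply: funext => f; exact: XY. Qed.

Lemma vfieldDE X Y f : (X + Y) f = X f + Y f. Proof. by []. Qed.
Lemma vfieldNE X f : (- X) f = - X f. Proof. by []. Qed.
Lemma vfieldZE h X f : (h *: X) f = h * X f. Proof. by []. Qed.
Lemma vfield0E f : (0 : vfield M) f = 0. Proof. by []. Qed.
Definition vfieldE := (vfieldDE, vfieldNE, vfieldZE, vfield0E).

Lemma vfield_appD X f h : X (f + h) = X f + X h.
Proof. by case: (vfieldP X). Qed.

Lemma vfield_appM X f h : X (f * h) = X f * h + f * X h.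
Proof. by case: (vfieldP X). Qed.

Lemma vfield_app0 X : X 0 = 0.
Proof. by apply: (@addrI _ (X 0)); rewrite -vfield_appD !addr0. Qed.

Lemma vfield_appN X f : X (- f) = - X f.
Proof. by apply/eqP; rewrite -addr_eq0 -vfield_appD addNr vfield_app0. Qed.

Lemma vfield_app1 X : X 1 = 0.
Proof.
apply: (@addrI _ (X 1)); rewrite addr0.
by rewrite -[in RHS](mulr1 1) vfield_appM mulr1 mul1r.
Qed.

Lemma vfield_app_const X (a : R) : X (cinf_const M a) = 0.
Proof.
by case: (vfieldP X) => _ XZ _; rewrite /cinf_const XZ vfield_app1 scaler0.
Qed.

Definition vfield_appE :=
  (vfield_appD, vfield_appN, vfield_appM, vfield_app0, vfield_app1,
   vfield_app_const).

Lemma scale_cinf_const (a : R) f : a *: f = cinf_const M a * f.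
Proof. by rewrite /cinf_const -cinf_scaleAl mul1r. Qed.

Lemma cinf_const_half (a : R) :
  cinf_const M (a / 2) + cinf_const M (a / 2) = cinf_const M a.
Proof. by rewrite /cinf_const -scalerDl -splitr. Qed.

Lemma cinf_halfK f : cinf_const M 2^-1 * (f + f) = f.
Proof.
have -> : f + f = (2 : R) *: f by rewrite scaler_nat.
by rewrite -scale_cinf_const scalerA mulVf ?scale1r// pnatr_eq0.
Qed.

Lemma cinf_add_self f h : f + f = h + h -> f = h.
Proof. by move=> fh; rewrite -(cinf_halfK f) fh cinf_halfK. Qed.

Lemma vfield_add_self X Y : X + X = Y + Y -> X = Y.
Proof.
move=> XY; apply: vfield_ext => f; apply: cinf_add_self.
by rewrite -!vfieldDE XY.
Qed.

(** Smooth functions need not form an integral domain, but their values at each point lie in a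
    field. *)
Lemma cinf_sqr_eq0 f : f * f = 0 -> f = 0.
Proof.
move=> ff; apply: val_inj; apply: funext => x.
have : cinf_fun (f * f) x = 0 by rewrite ff.
by move/eqP; rewrite mulf_eq0 orbb => /eqP.
Qed.

Lemma lieE X Y f : [lie X, Y] f = X (Y f) - Y (X f). Proof. by []. Qed.

Ltac vfield_ring :=
  apply: vfield_ext => ?;
  rewrite !(vfieldE, lieE, vfield_appE); ring.

Lemma eta_scale (eta : {scalar vfield M}) f X : eta (f *: X) = f * eta X.
Proof. exact: linearZ. Qed.

Lemma lieC X Y : [lie X, Y] = - [lie Y, X].
Proof. vfield_ring. Qed.

Lemma lie0r X : [lie X, 0] = 0.
Proof. vfield_ring. Qed.

Lemma lie0l X : [lie 0, X] = 0.
Proof. vfield_ring. Qed.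

Lemma lieNr X Y : [lie X, - Y] = - [lie X, Y].
Proof. vfield_ring. Qed.

Lemma lie_jacobi X Y Z :
  [lie X, [lie Y, Z]] = [lie [lie X, Y], Z] + [lie Y, [lie X, Z]].
Proof. vfield_ring. Qed.

End VectorFields.


(** * Metric, Killing fields and the Levi-Civita connection *)

Section Metric.
Variables (R : realType) (d : nat) (M : smoothManifold R d).
Variable g : riemannian_metric M.
Implicit Types (X Y Z : vfield M) (f h : Cinf M).

Lemma riemDr X Y Z : g X (Y + Z) = g X Y + g X Z.
Proof. by rewrite riem_sym riem_add !(riem_sym _ X). Qed.

Lemma riemZr h X Y : g X (h *: Y) = h * g X Y.
Proof. by rewrite riem_sym riem_scale riem_sym. Qed.

Lemma riemNl X Y : g (- X) Y = - g X Y.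
Proof. by rewrite -scaleN1r riem_scale mulN1r. Qed.

Lemma riemNr X Y : g X (- Y) = - g X Y.
Proof. by rewrite riem_sym riemNl riem_sym. Qed.

Lemma riem0l X : g 0 X = 0.
Proof. by rewrite -(scale0r (0 : vfield M)) riem_scale mul0r. Qed.

Definition riemE := (riem_add, riemDr, riem_scale, riemZr, riemNl, riemNr).

Lemma riem_zero_at (x : M) X : g X X x = 0 -> zero_at x X.
Proof.
by move=> gX0; apply: contrapT => /(riem_pos g); rewrite gX0 ltxx.
Qed.

Lemma riem_def X : g X X = 0 -> X = 0.
Proof.
move=> gX0; apply: vfield_ext => f; apply: val_inj; apply: funext => x.
by apply: riem_zero_at; rewrite gX0.
Qed.

Lemma riem_inj X Y : (forall Z, g X Z = g Y Z) -> X = Y.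
Proof.
move=> gXY; apply/eqP; rewrite -subr_eq0; apply/eqP/riem_def.
by rewrite !riemE !gXY; ring.
Qed.

Definition killing (xi : vfield M) :=
  forall Y Z, xi (g Y Z) = g [lie xi, Y] Z + g Y [lie xi, Z].

(** This is [2 d eta]; leaving out the scalar 1/2 of [d1] lets [ring] do the computations. *)
Definition dform (eta : vfield M -> Cinf M) X Y :=
  X (eta Y) - Y (eta X) - eta [lie X, Y].

Lemma d1_double (eta : vfield M -> Cinf M) X Y : d1 eta X Y *+ 2 = dform eta X Y.
Proof.
by rewrite /d1 scale_cinf_const mulr2n -mulrDr cinf_halfK.
Qed.

Lemma d2_eq0 (w : vfield M -> vfield M -> Cinf M) X Y Z : d2 w X Y Z = 0 ->
  X (w Y Z) + Y (w Z X) + Z (w X Y) =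
  w [lie X, Y] Z + w [lie Y, Z] X + w [lie Z, X] Y.
Proof.
move=> /(congr1 (fun f => (3 : R) *: f)).
rewrite /d2 scalerA mulfV ?pnatr_eq0// scale1r scaler0 => E.
by apply/eqP; rewrite -subr_eq0 !opprD !addrA E.
Qed.

Variable nabla : connection M.
Hypothesis LC : levi_civita g nabla.

Lemma nablaNl X Y : nabla (- X) Y = - nabla X Y.
Proof. by rewrite -scaleN1r (nabla_scalel LC) scaleN1r. Qed.

Lemma nablaNr X Y : nabla X (- Y) = - nabla X Y.
Proof.
rewrite -scaleN1r (nabla_leibniz LC) vfield_appN vfield_app1 oppr0.
by rewrite scale0r add0r scaleN1r.
Qed.

Lemma nabla_const (a : R) X Y :
  nabla X (cinf_const M a *: Y) = cinf_const M a *: nabla X Y.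
Proof. by rewrite (nabla_leibniz LC) vfield_app_const scale0r add0r. Qed.

Lemma nabla_lie X Y : nabla X Y = [lie X, Y] + nabla Y X.
Proof. by rewrite -(nabla_torsion_free LC) subrK. Qed.

Lemma nabla0r X : nabla X 0 = 0.
Proof.
rewrite -(scale0r (0 : vfield M)) (nabla_leibniz LC) vfield_app0.
by rewrite !scale0r addr0.
Qed.

(** Torsion-freeness turns the brackets of the Killing equation into covariant derivatives; metric
    compatibility then cancels everything but the derivatives of [xi]. *)
Lemma killing_skew (xi X Y : vfield M) :
  killing xi -> g (nabla X xi) Y = - g X (nabla Y xi).
Proof.
move=> /(_ X Y); rewrite (nabla_metric LC).
rewrite (nabla_lie xi X) (nabla_lie xi Y) !riemE.
move=> E; apply/eqP; rewrite -addr_eq0; apply/eqP.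
apply: (@addrI _ (g [lie xi, X] Y + g X [lie xi, Y])).
by rewrite addr0 -[RHS]E; ring.
Qed.

Lemma killing_dform (xi X Y : vfield M) : killing xi ->
  dform (g^~ xi) X Y = g (nabla X xi) Y + g (nabla X xi) Y.
Proof.
move=> kxi; rewrite /dform !(nabla_metric LC).
(* The derivatives of [X] and [Y] cancel against the bracket; skewness makes the two remaining terms
   equal. *)
rewrite [g X _](_ : _ = - g (nabla X xi) Y); last first.
  by rewrite (killing_skew _ _ kxi) opprK.
rewrite -(nabla_torsion_free LC X Y) !riemE.
by rewrite (riem_sym g Y); ring.
Qed.

End Metric.

(** * A single quasi-Sasakian structure *)

Section QuasiSasakian.
Variables (R : realType) (d : nat) (M : smoothManifold R d).
Variables (g : riemannian_metric M) (phi : {linear vfield M -> vfield M}).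
Variables (xi : vfield M) (eta : {scalar vfield M}).
Implicit Types (X Y Z : vfield M).

Section AlmostContact.
Hypothesis acm : almost_contact_metric g phi xi eta.

(** By [phi_sq] at [phi xi], the field [phi xi] is a multiple of [xi]; applying [phi] and then [eta]
    shows that the coefficient has square zero. *)
Lemma acm_phi_xi : phi xi = 0.
Proof.
have p2 : phi (phi xi) = 0.
  by rewrite (phi_sq acm) (eta_xi acm) scale1r addNr.
have e0 : phi xi = eta (phi xi) *: xi.
  by apply/eqP; rewrite -subr_eq0 -oppr_eq0 opprB addrC -(phi_sq acm) p2 linear0.
have e1 : eta (phi xi) *: phi xi = 0.
  by rewrite -linearZ -e0 p2.
have e2 : eta (phi xi) = 0.
  apply: cinf_sqr_eq0; have := congr1 eta e1.
  by rewrite linearZ linear0.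
by rewrite e0 e2 scale0r.
Qed.

(** Expand the cube of [phi] at [X] in two ways. *)
Lemma acm_eta_phi X : eta (phi X) = 0.
Proof.
have := phi_sq acm (phi X).
rewrite (phi_sq acm X) linearD linearN linearZ /= acm_phi_xi scaler0 addr0.
rewrite -[LHS]addr0 => /addrI /(congr1 eta).
by rewrite linear0 linearZ /= (eta_xi acm) mulr1.
Qed.

Lemma acm_etaE X : eta X = g X xi.
Proof.
apply/eqP; rewrite eq_sym -subr_eq0 -[eta X]mulr1 -(eta_xi acm).
by rewrite -(phi_metric acm) acm_phi_xi riem_sym riem0l.
Qed.

Lemma acm_skew X Y : g (phi X) Y = - g X (phi Y).
Proof.
have := phi_metric acm (phi X) Y.
rewrite acm_eta_phi mul0r subr0 (phi_sq acm) !riemE.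
by rewrite [g xi _]riem_sym -acm_etaE acm_eta_phi mulr0 addr0.
Qed.

Lemma fundamental_skew X Y :
  fundamental_form g phi X Y = - fundamental_form g phi Y X.
Proof. by rewrite /fundamental_form riem_sym acm_skew. Qed.

End AlmostContact.

Hypothesis qS : quasi_sasakian g phi xi eta.
Let acm := qs_acm qS.

Lemma qs_normalE X Y :
  nijenhuis phi X Y + dform eta X Y *: xi = 0.
Proof. by rewrite -d1_double (qs_normal qS). Qed.

(** As [phi xi = 0], every surviving term of the torsion at [(X, xi)] lies in the image of [phi],
    which [eta] kills. *)
Lemma qs_dform_xi X : dform eta X xi = 0.
Proof.
have := congr1 eta (qs_normalE X xi).
rewrite /nijenhuis (acm_phi_xi acm) !lie0r.
rewrite linear0 subr0 addr0 raddfD raddfB /= eta_scale !(acm_eta_phi acm).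
by rewrite (eta_xi acm) mulr1 subr0 add0r linear0.
Qed.

Lemma qs_eta_lie X : eta [lie xi, X] = xi (eta X).
Proof.
have := qs_dform_xi X; rewrite /dform (eta_xi acm) vfield_app1 lieC raddfN.
by rewrite sub0r opprK => /eqP; rewrite addrC subr_eq0 => /eqP.
Qed.

(** Normality at [(xi, X)] shows that [phi] kills the difference of the two sides; [eta] kills it
    too, and by [phi_sq] only 0 is killed by both. *)
Lemma qs_phi_lie X : [lie xi, phi X] = phi [lie xi, X].
Proof.
apply/eqP; rewrite -subr_eq0; set Y := _ - _.
have eY : eta Y = 0.
  by rewrite raddfB /= qs_eta_lie !(acm_eta_phi acm) vfield_app0 subrr.
have pY : phi Y = 0.
  have := qs_normalE xi X.
  rewrite /nijenhuis (acm_phi_xi acm).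
  have -> : dform eta xi X = 0.
    by rewrite /dform qs_eta_lie (eta_xi acm) vfield_app1 subr0 subrr.
  rewrite !lie0l linear0 subr0 addr0 scale0r addr0 => E.
  by rewrite /Y linearB /= -opprB E oppr0.
have := phi_sq acm Y; rewrite pY linear0 eY scale0r addr0 => /eqP.
by rewrite eq_sym oppr_eq0.
Qed.

(** The fundamental form is closed and contracts to 0 with [xi], so [xi] preserves it ([LPhi]). It
    also preserves [phi] and [eta], and [gE] expresses the metric through these three. *)
Lemma qs_killing : killing g xi.
Proof.
have LPhi Y Z : xi (g Y (phi Z)) = g [lie xi, Y] (phi Z) + g Y (phi [lie xi, Z]).
  have := d2_eq0 (qs_closed qS xi Y Z); rewrite /fundamental_form.
  rewrite (acm_phi_xi acm) ![g xi _]riem_sym -!(acm_etaE acm) !(acm_eta_phi acm).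
  rewrite ![g _ 0]riem_sym !riem0l !vfield_app0 !addr0 => ->.
  by rewrite (lieC Z) riemNl [g _ (phi Y)]riem_sym (acm_skew acm) opprK riem_sym.
have gE Y Z : g Y Z = eta Y * eta Z - g Y (phi (phi Z)).
  by rewrite (phi_sq acm) !riemE -(acm_etaE acm); ring.
move=> Y Z; rewrite (gE Y Z) (gE _ Z) (gE Y [lie xi, Z]) !vfield_appE LPhi.
by rewrite !qs_eta_lie !qs_phi_lie; ring.
Qed.

Variable nabla : connection M.
Hypothesis LC : levi_civita g nabla.

Lemma qs_dformE X Y :
  dform eta X Y = g (nabla X xi) Y + g (nabla X xi) Y.
Proof.
rewrite -(killing_dform LC X Y qs_killing) /dform.
by rewrite !(acm_etaE acm).
Qed.

(** Under [eta], the normality equation reduces to the bracket of [phi X] and [phi Y] and the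
    [dform] term. *)
Lemma qs_dform_phi X Y : dform eta (phi X) (phi Y) = dform eta X Y.
Proof.
have := congr1 eta (qs_normalE X Y).
rewrite linear0 /nijenhuis raddfD !raddfB raddfD /= eta_scale.
rewrite !(acm_eta_phi acm) (eta_xi acm) mulr1 add0r !subr0 => E.
by rewrite {1}/dform !(acm_eta_phi acm) !vfield_app0 subr0 -E; ring.
Qed.

Lemma qs_eta_nabla X : eta (nabla X xi) = 0.
Proof.
apply: cinf_add_self; rewrite (acm_etaE acm) -(qs_dformE X xi).
by rewrite qs_dform_xi addr0.
Qed.

(** The operator [nabla _ xi] represents the [phi]-invariant form [dform eta], and [phi] is skew. *)
Lemma qs_nabla_phi X : nabla (phi X) xi = phi (nabla X xi).
Proof.
apply: (riem_inj (g := g)) => Y.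
have E : g (nabla (phi X) xi) (phi (phi Y)) = g (nabla X xi) (phi Y).
  apply: cinf_add_self.
  by rewrite -!qs_dformE qs_dform_phi.
move: E; rewrite (phi_sq acm) !riemE -(acm_etaE acm) qs_eta_nabla mulr0 addr0.
by rewrite (acm_skew acm) => <-; rewrite opprK.
Qed.

End QuasiSasakian.

(** * Even permutations of three indices *)

Section EvenPermutations.

Lemma even_permutation_cycle a b e :
  even_permutation a b e -> even_permutation b e a.
Proof.
case=> s es [-> -> ->].
have n01 : (inord 0 : 'I_3) != inord 1 by rewrite -val_eqE /= !inordK.
have n02 : (inord 0 : 'I_3) != inord 2 by rewrite -val_eqE /= !inordK.
have n12 : (inord 1 : 'I_3) != inord 2 by rewrite -val_eqE /= !inordK.
(* Precompose with the 3-cycle 0 -> 1 -> 2 -> 0, written as two transpositions. *)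
exists (tperm (inord 0) (inord 1) * (tperm (inord 0) (inord 2) * s))%g.
  by rewrite !odd_permM !odd_tperm n01 n02 /= negbK.
split; rewrite !permM ?tpermL ?tpermR //.
- by rewrite tpermD // eq_sym n12.
- by rewrite tpermL.
- by rewrite (tpermD n02 n12) tpermR.
Qed.

Lemma even_permutation_neq a b e : even_permutation a b e -> a != b.
Proof.
by case=> s _ [-> -> _]; rewrite (inj_eq perm_inj) -val_eqE /= !inordK.
Qed.

Lemma even_permutation_complete (a b : 'I_3) : a != b ->
  exists e, even_permutation a b e \/ even_permutation b a e.
Proof.
move=> ab.
have n01 : (inord 0 : 'I_3) != inord 1 by rewrite -val_eqE /= !inordK.
have n02 : (inord 0 : 'I_3) != inord 2 by rewrite -val_eqE /= !inordK.
have n12 : (inord 1 : 'I_3) != inord 2 by rewrite -val_eqE /= !inordK.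
(* Build [s] with 0 -> [a] and 1 -> [b]; if it is odd, exchanging 0 and 1 first gives an even
   permutation starting with [b], [a]. *)
pose t := tperm (inord 0) a.
have ta : t (inord 0) = a by rewrite tpermL.
pose s := (t * tperm (t (inord 1)) b)%g.
have s0 : s (inord 0) = a.
  by rewrite permM ta tpermD// 1?eq_sym// -ta (inj_eq perm_inj).
have s1 : s (inord 1) = b by rewrite permM tpermL.
exists (s (inord 2)).
have [os|es] := boolP (odd_perm s); [right|left]; last by exists s.
exists (tperm (inord 0) (inord 1) * s)%g.
  by rewrite odd_permM odd_tperm n01 os.
split; rewrite [RHS]permM.
- by rewrite tpermL s1.
- by rewrite tpermR s0.
- by rewrite (tpermD n02 n12).
Qed.

Lemma even_permutation_extend (a : 'I_3) : exists b e, even_permutation a b e.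
Proof.
have ab : a != lift a (ord0 : 'I_2) by rewrite neq_lift.
have [e [H|H]] := even_permutation_complete ab; first by exists (lift a ord0), e.
by exists e, (lift a ord0); apply: even_permutation_cycle.
Qed.

End EvenPermutations.

(** * Derivatives of the Reeb fields [xi a] and of the tensors [phi a] *)

Section ThreeQuasiSasakian.
Variables (R : realType) (d : nat) (M : smoothManifold R d).
Variables (g : riemannian_metric M) (phi : 'I_3 -> {linear vfield M -> vfield M}).
Variables (xi : 'I_3 -> vfield M) (eta : 'I_3 -> {scalar vfield M}).
Variables (nabla : connection M) (c : R).
Hypothesis T : three_quasi_sasakian g phi xi eta.
Hypothesis bracket : forall a b e, even_permutation a b e ->
  [lie xi a, xi b] = cinf_const M c *: xi e.
Hypothesis LC : levi_civita g nabla.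
Implicit Types (X Y Z : vfield M) (a b e : 'I_3).

Let qs a := tqs_qs T a.
Let acm a := qs_acm (qs a).
Let kil a : killing g (xi a) := qs_killing (qs a).
Let even_cycle := even_permutation_cycle.
Let h := cinf_const M (c / 2).
Local Notation B a X := (nabla X (xi a)).

Let etaE a X : eta a X = g X (xi a). Proof. exact: acm_etaE (acm a) X. Qed.

Let hh : cinf_const M c = h + h. Proof. by rewrite /h cinf_const_half. Qed.

Let B_skew a X Y : g (B a X) Y = - g X (B a Y).
Proof. by rewrite (killing_skew LC). Qed.

(** In an even triple, the third Reeb field is, up to sign, in the image of [phi] for each of the
    other two indices, and [eta] vanishes on the image of its own [phi]. *)
Lemma tqs_eta_xi a b : a != b -> eta a (xi b) = 0.
Proof.
have H a' b' e' : even_permutation a' b' e' ->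
    eta a' (xi e') = 0 /\ eta b' (xi e') = 0.
  move=> ev; have [E1 E2] := tqs_xi T ev; split.
    by rewrite E1 (acm_eta_phi (acm a')).
  by rewrite E2 raddfN /= (acm_eta_phi (acm b')) oppr0.
move=> /even_permutation_complete[e [ev|ev]].
  by have [] := H _ _ _ (even_cycle (even_cycle ev)).
by have [] := H _ _ _ (even_cycle ev).
Qed.

Lemma tqs_nabla_self a : B a (xi a) = 0.
Proof.
apply: (riem_inj (g := g)) => Y.
by rewrite B_skew riem_sym -etaE (qs_eta_nabla (qs a) LC) oppr0 riem0l.
Qed.

Let B_swap a b : a != b -> B a (xi b) = - B b (xi a).
Proof.
move=> ab; apply: (riem_inj (g := g)) => Y; rewrite B_skew riemNl B_skew opprK.
have := nabla_metric LC Y (xi b) (xi a).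
rewrite -etaE tqs_eta_xi// vfield_app0 => /esym/eqP.
by rewrite addrC addr_eq0 [g _ (xi a)]riem_sym => /eqP ->; rewrite opprK.
Qed.

(** Orthogonality of the Reeb fields makes the two derivatives opposite ([B_swap]), and by
    torsion-freeness their difference is the bracket; each is half of it up to sign. *)
Lemma tqs_nabla_xi a b e : even_permutation a b e ->
  B a (xi b) = - (h *: xi e) /\ B b (xi a) = h *: xi e.
Proof.
move=> ev.
have ab := even_permutation_neq ev.
suff E : B b (xi a) = h *: xi e by rewrite B_swap// E.
apply: vfield_add_self; rewrite -scalerDl -hh -(bracket ev).
by rewrite -(nabla_torsion_free LC) (B_swap ab) opprK.
Qed.

Let B_xi a b : exists k e, B a (xi b) = k *: xi e.
Proof.
have [->|ab] := eqVneq a b; first by exists 0, b; rewrite tqs_nabla_self scale0r.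
have [e [ev|ev]] := even_permutation_complete ab.
  by exists (- h), e; rewrite (tqs_nabla_xi ev).1 scaleNr.
by exists h, e; rewrite (tqs_nabla_xi ev).2.
Qed.

(* Cartan's formula for the closed form [Phi b]: its Lie derivative along [xi a]
   is the differential of [Phi b (xi a, _) = eta a \o phi b]. *)
Let lie_phi_form a b (theta : vfield M -> Cinf M) :
    (forall X, eta a (phi b X) = theta X) ->
  forall X Y, g X ([lie xi a, phi b Y] - phi b [lie xi a, Y]) = dform theta X Y.
Proof.
move=> th X Y.
have := d2_eq0 (qs_closed (qs b) (xi a) X Y).
rewrite ![fundamental_form _ _ _ (xi a)](fundamental_skew (acm b)).
rewrite /fundamental_form.
rewrite ![g (xi a) _]riem_sym -!etaE !th !vfield_appN (kil a X (phi b Y)).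
rewrite (lieC Y) riemNl -(acm_skew (acm b)) (riem_sym _ (phi b _)).
rewrite !riemE /dform => /eqP; rewrite -subr_eq0 => /eqP E.
by apply/eqP; rewrite -subr_eq0; apply/eqP; rewrite -[RHS]E; ring.
Qed.

(** Since [eta a \o phi b] is [eta e] and [eta a \o phi e] is [- eta b], [lie_phi_form] yields their
    differentials, which [B e] and [B b] represent. *)
Lemma tqs_lie_phi a b e X : even_permutation a b e ->
  [lie xi a, phi b X] = phi b [lie xi a, X] - (B e X + B e X) /\
  [lie xi a, phi e X] = phi e [lie xi a, X] + (B b X + B b X).
Proof.
move=> ev; split; rewrite addrC; apply/eqP; rewrite -subr_eq; apply/eqP.
  apply: (riem_inj (g := g)) => Y.
  have := lie_phi_form (fun Z => esym (tqs_eta T ev Z).1) Y X.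
  rewrite (qs_dformE (qs e) LC) !riemE !(riem_sym g _ Y) => ->.
  by rewrite B_skew; ring.
apply: (riem_inj (g := g)) => Y.
have th Z : eta a (phi e Z) = - eta b Z.
  by rewrite (tqs_eta T (even_cycle (even_cycle ev)) Z).2 opprK.
have := lie_phi_form th Y X.
rewrite {1}/dform !vfield_appN => E.
rewrite riem_sym E (riem_sym g _ Y).
have := qs_dformE (qs b) LC Y X; rewrite /dform !riemE B_skew => F.
by rewrite -[RHS]opprK opprD -F; ring.
Qed.

(** * Horizontal fields and the operator S *)

Definition horizontal_field X := forall a, eta a X = 0.
Local Notation hor := horizontal_field.

Lemma hor_phi a X : hor X -> hor (phi a X).
Proof.
move=> hX b; have [->|ab] := eqVneq a b; first exact: acm_eta_phi (acm b) X.
have [e [ev|ev]] := even_permutation_complete ab.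
  by rewrite -[LHS]opprK -(tqs_eta T ev X).2 hX oppr0.
by rewrite -(tqs_eta T ev X).1 hX.
Qed.

(** Skewness moves [B a] onto [xi b], where it gives a multiple of a Reeb field. *)
Lemma hor_nabla a X : hor X -> hor (B a X).
Proof.
move=> hX b; rewrite etaE B_skew; have [k [e ->]] := B_xi a b.
by rewrite riemZr -etaE hX mulr0 oppr0.
Qed.

(** The field [xi a] is Killing, and its brackets with the Reeb fields are combinations of Reeb
    fields. *)
Lemma hor_lie a X : hor X -> hor [lie xi a, X].
Proof.
move=> hX b.
have := kil a X (xi b); rewrite -!etaE hX vfield_app0.
rewrite -(nabla_torsion_free LC (xi a) (xi b)).
have [k [e ->]] := B_xi b a; have [k' [e' ->]] := B_xi a b.
by rewrite !riemE -!etaE !hX !mulr0 subr0 addr0.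
Qed.

Lemma phi_phi a X : hor X -> phi a (phi a X) = - X.
Proof. by move=> hX; rewrite (phi_sq (acm a)) hX scale0r addr0. Qed.

Lemma phi_even a b e X : even_permutation a b e -> hor X ->
  phi a (phi b X) = phi e X /\ phi b (phi a X) = - phi e X.
Proof.
move=> ev hX; have [E1 E2] := tqs_phi T ev X.
rewrite hX scale0r in E1; rewrite hX scale0r in E2.
split; first by rewrite E1 subr0.
by rewrite E2 addr0 opprK.
Qed.

(* Differentiate [phi e = phi a \o phi b] along [xi a]. *)
Lemma nabla_even a b e X : even_permutation a b e -> hor X ->
  B b X = - phi a (B e X).
Proof.
move=> ev hX; have hL := hor_lie a hX.
apply: vfield_add_self; apply: (@addrI _ (phi e [lie xi a, X])).
rewrite -(tqs_lie_phi X ev).2 -(phi_even ev hX).1 (qs_phi_lie (qs a)).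
by rewrite (tqs_lie_phi X ev).1 linearB linearD /= (phi_even ev hL).1 opprD.
Qed.

Lemma phi_nabla_const a b X : hor X -> phi a (B a X) = phi b (B b X).
Proof.
have H a' b' e' Y : even_permutation a' b' e' -> hor Y ->
    phi b' (B b' Y) = phi e' (B e' Y).
  move=> ev hY.
  have E : B e' Y = phi a' (B b' Y).
    by rewrite (nabla_even ev hY) linearN /= phi_phi ?opprK//; apply: hor_nabla.
  by rewrite E (phi_even (even_cycle (even_cycle ev)) _).1//; apply: hor_nabla.
move=> hX; have [->//|ab] := eqVneq a b.
have [e [ev|ev]] := even_permutation_complete ab.
  by rewrite (H e a b)//; do 2!apply: even_cycle.
by rewrite (H e b a)//; do 2!apply: even_cycle.
Qed.

(* On horizontal fields, [phi a \o nabla (xi a)] does not depend on [a]. *)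
Definition shape X := phi ord0 (B ord0 X).
Local Notation S := shape.

Lemma shapeE a X : hor X -> S X = phi a (B a X).
Proof. exact: phi_nabla_const. Qed.

Lemma hor_shape X : hor X -> hor (S X).
Proof. by move=> hX; apply: hor_phi; apply: hor_nabla. Qed.

Lemma shape_phi a X : hor X -> S (phi a X) = phi a (S X).
Proof.
move=> hX; rewrite (shapeE a (hor_phi a hX)) (shapeE a hX).
by rewrite (qs_nabla_phi (qs a) LC).
Qed.

Lemma nabla_shape a X : hor X -> B a X = - phi a (S X).
Proof.
by move=> hX; rewrite (shapeE a hX) phi_phi ?opprK//; apply: hor_nabla.
Qed.

Lemma shapeD X Y : S (X + Y) = S X + S Y.
Proof. by rewrite /S (nabla_addl LC) linearD. Qed.

Lemma shapeZ (f : Cinf M) X : S (f *: X) = f *: S X.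
Proof. by rewrite /S (nabla_scalel LC) linearZ. Qed.

(** A product of two commuting skew operators is symmetric. *)
Lemma shape_sym X Y : g (S X) Y = g X (S Y).
Proof.
by rewrite /S (acm_skew (acm _)) B_skew opprK (qs_nabla_phi (qs _) LC).
Qed.

(** By [eL], the Lie derivative of [eta b] along [xi a] is [k] times [eta e]. Lie derivatives
    commute with the differential (by Jacobi), and the Killing field [xi a] preserves the metric
    that turns [dform] into [B]. A free [s] covers both orientations of the triple, and the case
    [a = b] with [s = 0]. *)
Lemma tqs_lie_nabla a b e (s : R) X :
  [lie xi a, xi b] = cinf_const M s *: xi e ->
  [lie xi a, B b X] = B b [lie xi a, X] + cinf_const M s *: B e X.
Proof.
move=> ab; set k := cinf_const M s.
have eL Y : eta b [lie xi a, Y] = xi a (eta b Y) - k * eta e Y.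
  by rewrite !etaE (kil a Y (xi b)) ab riemZr; ring.
apply: (riem_inj (g := g)) => Y; apply: cinf_add_self.
have LB := kil a (B b X) Y.
have -> : g [lie xi a, B b X] Y = xi a (g (B b X) Y) - g (B b X) [lie xi a, Y].
  by rewrite LB; ring.
rewrite !riemE.
have D b' U V : g (B b' U) V + g (B b' U) V = dform (eta b') U V.
  by rewrite (qs_dformE (qs b') LC).
have : xi a (dform (eta b) X Y) = dform (eta b) [lie xi a, X] Y +
    dform (eta b) X [lie xi a, Y] + k * dform (eta e) X Y.
  have := congr1 (eta b) (lie_jacobi (xi a) X Y); rewrite eL raddfD /= => J.
  rewrite /dform !eL !(lieE, vfield_appE).
  rewrite -[eta b [lie [lie xi a, X], Y]](addrK (eta b [lie X, [lie xi a, Y]])).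
  by rewrite -J; ring.
rewrite -!D vfield_appD => /eqP; rewrite -subr_eq0 => /eqP F.
by apply/eqP; rewrite -subr_eq0; apply/eqP; rewrite -[RHS]F; ring.
Qed.

Lemma tqs_lie_nabla_self a X : [lie xi a, B a X] = B a [lie xi a, X].
Proof.
rewrite (@tqs_lie_nabla a a a 0) /cinf_const !scale0r ?addr0//.
by apply: vfield_ext => f; rewrite lieE subrr.
Qed.

Lemma lie_even a b e : even_permutation a b e ->
  [lie xi b, xi a] = cinf_const M (- c) *: xi e.
Proof. by move=> ev; rewrite lieC (bracket ev) /cinf_const !scaleNr. Qed.

Lemma lie_shape a X : hor X -> [lie xi a, S X] = S [lie xi a, X].
Proof.
move=> hX; rewrite (shapeE a hX) (shapeE a (hor_lie a hX)).
by rewrite (qs_phi_lie (qs a)) tqs_lie_nabla_self.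
Qed.

(* Differentiate [B b = - phi b \o S] along [xi a]. *)
Lemma shape_sqr X : hor X -> S (S X) = h *: S X.
Proof.
move=> hX; have [b [e ev]] := even_permutation_extend (ord0 : 'I_3).
set a := ord0 in ev.
have hS := hor_shape hX; have hL := hor_lie a hX.
have E : B e (S X) = h *: B e X.
  apply: vfield_add_self; rewrite -scalerDl -hh.
  apply: (@addrI _ (B b [lie xi a, X])).
  rewrite -(tqs_lie_nabla X (bracket ev)) (nabla_shape b hX) lieNr.
  by rewrite (tqs_lie_phi _ ev).1 (lie_shape a hX) (nabla_shape b hL) opprB addrC.
by rewrite (shapeE e hS) E linearZ /= -(shapeE e hX).
Qed.

(** * Curvature in the Reeb directions *)

Lemma curvature_xi a b X : hor X ->
  curvature nabla X (xi b) (xi a) =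
  nabla X (B a (xi b)) - [lie xi b, B a X] + B a [lie xi b, X] - B b (B a X).
Proof.
(* Trade the derivative along [xi b] for a bracket, to which [tqs_lie_nabla] applies. *)
move=> hX; rewrite /curvature (nabla_lie LC (xi b) (B a X)) (lieC X) (nablaNl LC).
by rewrite opprK opprD !addrA [RHS]addrAC.
Qed.

Lemma nabla_nabla a b X : hor X -> B b (B a X) = phi b (phi a (S (S X))).
Proof.
move=> hX; have hS := hor_shape hX.
rewrite (nabla_shape a hX) (nablaNl LC) (nabla_shape b (hor_phi a hS)) opprK.
by rewrite (shape_phi a hS).
Qed.

Lemma curvature_xi_self a X : hor X -> curvature nabla X (xi a) (xi a) = S (S X).
Proof.
move=> hX; rewrite curvature_xi// tqs_nabla_self (nabla0r LC) tqs_lie_nabla_self.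
rewrite sub0r addNr sub0r nabla_nabla// phi_phi ?opprK//.
by do 2!apply: hor_shape.
Qed.

(** Every contribution is a multiple of [B e X]: for even [(a, b, e)] the coefficients are [-h] from
    [B a (xi b)], [2h] from the brackets and [-h] from [B b (B a X)]. The other orientation reverses
    all signs. *)
Lemma curvature_xi_neq a b X : hor X -> a != b ->
  curvature nabla X (xi b) (xi a) = 0.
Proof.
move=> hX ab; rewrite curvature_xi// nabla_nabla// shape_sqr// !linearZ /=.
have hS := hor_shape hX.
have hc : cinf_const M (- c) = - (h + h) by rewrite -hh /cinf_const scaleNr.
have [e [ev|ev]] := even_permutation_complete ab.
  rewrite (tqs_lie_nabla X (lie_even ev)) (phi_even ev hS).2 (tqs_nabla_xi ev).1.
  rewrite (nablaNr LC) (nabla_const LC) -/h hc (nabla_shape e hX).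
  by apply: vfield_ext => f; rewrite !vfieldE; ring.
rewrite (tqs_lie_nabla X (bracket ev)) (phi_even ev hS).1 (tqs_nabla_xi ev).2.
rewrite (nabla_const LC) -/h hh (nabla_shape e hX).
by apply: vfield_ext => f; rewrite !vfieldE; ring.
Qed.

(** * The two distributions as eigenspaces of S *)

Lemma E4m_shape X : section_of (E4m eta) X -> hor X /\ S X = 0.
Proof.
move=> EX; have hX : hor X.
  move=> a; apply: val_inj; apply: funext => x; have [+ _] := EX x; exact.
split=> //; apply: vfield_ext => f; apply: val_inj; apply: funext => x.
(* The index [a] may vary with the point [x], but the norm of [B a X] is that of [S X] for every
   [a]; test the form against [B a X]. *)
apply: (riem_zero_at (g := g)); have [_ [a da]] := EX x.
have -> : g (S X) (S X) = g (B a X) (B a X).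
  have hS := hor_shape hX.
  rewrite (nabla_shape a hX) riemNl riemNr opprK.
  by rewrite (phi_metric (acm a)) hS mul0r subr0.
have := da (B a X).
have -> : d1 (eta a) X (B a X) = g (B a X) (B a X); last by [].
by apply: cinf_add_self; rewrite -mulr2n d1_double (qs_dformE (qs a) LC).
Qed.

Lemma shape_E4m X : hor X -> S X = 0 -> section_of (E4m eta) X.
Proof.
move=> hX SX x; split=> [a|]; first by rewrite hX.
exists ord0 => Y; suff -> : d1 (eta ord0) X Y = 0 by [].
apply: cinf_add_self; rewrite -mulr2n d1_double (qs_dformE (qs _) LC).
by rewrite (nabla_shape _ hX) SX linear0 oppr0 riem0l.
Qed.

Lemma E4m_nabla a X : section_of (E4m eta) X -> B a X = 0.
Proof.
by move=> /E4m_shape[hX SX]; rewrite (nabla_shape a hX) SX linear0 oppr0.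
Qed.

(* [h *: X - S X] lies in [E4m], hence is orthogonal to [X] and to [S X]. *)
Lemma E4l_shape X : section_of (E4l g eta) X -> hor X /\ S X = h *: X.
Proof.
move=> EX; have hX : hor X.
  move=> a; apply: val_inj; apply: funext => x; have [+ _] := EX x; exact.
split=> //; have hS := hor_shape hX.
have [Y YE] : {Y | Y = h *: X - S X} by exists (h *: X - S X).
have hY : hor Y by move=> a; rewrite YE raddfB /= eta_scale hX hS mulr0 subr0.
have SY : S Y = 0.
  by rewrite YE shapeD shapeZ -scaleN1r shapeZ (shape_sqr hX) scaleN1r subrr.
have gXY : g X Y = 0.
  apply: val_inj; apply: funext => x.
  have [_ H] := EX x; exact/H/shape_E4m.
suff : Y = 0 by rewrite YE => /eqP; rewrite subr_eq0 => /eqP.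
apply: (riem_def (g := g)).
by rewrite {1}YE !riemE shape_sym SY gXY (riem_sym g X) riem0l; ring.
Qed.

(** Only the bracket term survives. Both [X] and [Y] preserve [eta a], so Jacobi shows that [[X, Y]]
    annihilates [dform (eta a)], hence [B a] kills it. *)
Lemma curvature_E4m a X Y : section_of (E4m eta) X -> section_of (E4m eta) Y ->
  curvature nabla X Y (xi a) = 0.
Proof.
move=> EX EY.
have D0 U V W : section_of (E4m eta) U -> dform (eta W) U V = 0.
  by move=> EU; rewrite (qs_dformE (qs W) LC) (E4m_nabla _ EU) riem0l addr0.
rewrite /curvature (E4m_nabla a EX) (E4m_nabla a EY) !(nabla0r LC) subr0 sub0r.
suff -> : B a [lie X, Y] = 0 by rewrite oppr0.
have hX := (E4m_shape EX).1; have hY := (E4m_shape EY).1.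
have etaX V : eta a [lie X, V] = X (eta a V).
  have /eqP := D0 X V a EX; rewrite /dform hX vfield_app0 subr0.
  by rewrite subr_eq0 => /eqP.
have etaY V : eta a [lie Y, V] = Y (eta a V).
  have /eqP := D0 Y V a EY; rewrite /dform hY vfield_app0 subr0.
  by rewrite subr_eq0 => /eqP.
apply: (riem_inj (g := g)) => Z; apply: cinf_add_self.
rewrite -(qs_dformE (qs a) LC) riem0l addr0 /dform etaX hY !vfield_app0.
have := congr1 (eta a) (lie_jacobi X Y Z).
rewrite raddfD /= !(etaX, etaY) => E.
by rewrite E; ring.
Qed.

End ThreeQuasiSasakian.

Theorem corollary4p8 (R : realType) (n l : nat)
    (M : smoothManifold R (4 * n + 3)%N) (g : riemannian_metric M)
    (phi : 'I_3 -> {linear vfield M -> vfield M}) (xi : 'I_3 -> vfield M)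
    (eta : 'I_3 -> {scalar vfield M}) (nabla : connection M) (c : R) :
  three_quasi_sasakian g phi xi eta ->
  (forall a, has_rank (eta a) (4 * l + 3)%N) ->
  (forall a b e, even_permutation a b e ->
     lie_bracket (xi a) (xi b) = cinf_const M c *: xi e) ->
  levi_civita g nabla ->
  [/\ (forall X Y : vfield M, section_of (E4m eta) X -> section_of (E4m eta) Y ->
        forall a, curvature nabla X Y (xi a) = 0),
      (forall X : vfield M, section_of (E4m eta) X ->
        forall a b, curvature nabla X (xi b) (xi a) = 0),
      (forall X : vfield M, section_of (E4l g eta) X ->
        forall a, curvature nabla X (xi a) (xi a) =
                  cinf_const M (c ^+ 2 / 4) *: X)
    & (forall X : vfield M, section_of (E4l g eta) X ->
        forall a b, a != b -> curvature nabla X (xi b) (xi a) = 0)] /\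
  [/\ (forall X : vfield M, section_of (E4m eta) X ->
        forall a, sectional g nabla (xi a) X = 0)
    & (forall X : vfield M, section_of (E4l g eta) X ->
        forall a, sectional g nabla (xi a) X = (c ^+ 2 / 4) *: g X X)].
Proof.
move=> T _ br LC.
have hh : cinf_const M (c ^+ 2 / 4) = cinf_const M (c / 2) * cinf_const M (c / 2).
  by rewrite -scale_cinf_const {2}/cinf_const scalerA mulf_div -natrM expr2.
have R4m X : section_of (E4m eta) X ->
    forall a b, curvature nabla X (xi b) (xi a) = 0.
  move=> EX a b; have [hX SX] := E4m_shape T br LC EX.
  have [->|ab] := eqVneq a b; last exact: (curvature_xi_neq T br LC).
  rewrite (curvature_xi_self T br LC)// SX /shape.
  by rewrite -(scale0r (0 : vfield M)) (nabla_scalel LC) linearZ /= !scale0r.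
have R4l X : section_of (E4l g eta) X -> forall a,
    curvature nabla X (xi a) (xi a) = cinf_const M (c ^+ 2 / 4) *: X.
  move=> EX a; have [hX SX] := E4l_shape T br LC EX.
  by rewrite (curvature_xi_self T br LC)// (shape_sqr T br LC)// SX scalerA -hh.
split; split=> //.
- by move=> X Y EX EY a; apply: (curvature_E4m T br LC).
- move=> X EX a b ab; apply: (curvature_xi_neq T br LC) ab.
  exact: (E4l_shape T br LC EX).1.
- by move=> X EX a; rewrite /sectional R4m// riem0l.
- by move=> X EX a; rewrite /sectional R4l// riem_scale scale_cinf_const.
Qed.
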